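(* Let $X$ be a directed space. Then $(PX, O_{\Rightarrow_P}(PX))$, with the binary operation $\widehat{F_1}\oplus\widehat{F_2}=\widehat{F_1\cup F_2}$, is the directed convex powerspace over $X$; that is, with $PX$ endowed with the topology $O_{\Rightarrow_P}(PX)$, $(PX,\oplus)\cong P_P(X)$.
   Context: All topological spaces are $T_0$. For a $T_0$ space $X$ with topology $O(X)$, the specialization order is $x\sqsubseteq y \iff x\in\overline{\{y\}}$; all order-theoretic notions on a space refer to it. For $A\subseteq X$, $\uparrow A=\{x:\exists a\in A,\ a\sqsubseteq x\}$, $\downarrow A=\{x:\exists a\in A,\ x\sqsubseteq a\}$. A directed set is a nonempty subset in which every nonempty finite subset has an upper bound. A directed set $D\subseteq X$, viewed as a net indexed by itself, converges to $x$, written $D\to x$, if it is eventually in every open neighbourhood of $x$; $\lim D$ denotes the set of all $x$ with $D\to x$. A subset $U\subseteq X$ is directed open if for every directed $D\subseteq X$ and $x\in U$ with $D\to x$ one has $D\cap U\ne\emptyset$; $d(X)$ is the family of directed open sets. $X$ is a directed space if it is $T_0$ and $d(X)=O(X)$. For directed spaces $X,Y$, $X\otimes Y$ is the set $X\times Y$ with the topology in which $U$ is open iff for every pointwise-directed $D\subseteq X\times Y$ and $(x,y)\in U$ with $\pi_1D\to x$ in $X$ and $\pi_2D\to y$ in $Y$ one has $U\cap D\ne\emptyset$. A directed semilattice is a directed space $X$ with a continuous operation $+:X\otimes X\to X$ that is idempotent, associative and commutative. A directed semilattice homomorphism is a continuous map preserving the operation. A directed space $Z$ is the directed convex powerspace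 over $X$ (denoted $P_P(X)$; it is unique up to a homeomorphism that is also a directed semilattice homomorphism) iff: (1) $Z$ is a directed semilattice $(Z,+)$; (2) there is a continuous $i:X\to Z$ such that for every directed semilattice $(Y,+)$ and every continuous $f:X\to Y$ there is a unique directed semilattice homomorphism $\bar f:(Z,+)\to(Y,+)$ with $f=\bar f\circ i$. For a nonempty finite $F\subseteq X$ put $\widehat F=(\downarrow F,\uparrow F)$, and let $PX=\{\widehat F: F\text{ a nonempty finite subset of }X\}$, ordered by $\widehat{F_1}\le_P\widehat{F_2}\iff \downarrow F_1\subseteq\downarrow F_2$ and $\uparrow F_2\subseteq\uparrow F_1$. For a $\le_P$-directed $\mathcal D=\{\widehat{F_i}\}_{i\in I}\subseteq PX$ and $\widehat F\in PX$, $\mathcal D\Rightarrow_P\widehat F$ means: there are finitely many directed sets $D_1,\dots,D_k\subseteq X$ such that (1) $D_j\subseteq\bigcup_{i\in I}\downarrow F_i$ for $j=1,\dots,k$; (2) $F\cap\lim D_j\ne\emptyset$ for $j=1,\dots,k$; (3) $F\subseteq\bigcup_{j=1}^k\lim D_j$; (4) for every $(d_1,\dots,d_k)\in\prod_{j=1}^kD_j$ there is $\widehat{F'}\in\mathcal D$ with $\uparrow F'\subseteq\uparrow\{d_1,\dots,d_k\}$. $O_{\Rightarrow_P}(PX)$ is the family of all $\mathcal U\subseteq PX$ such that for every directed $\mathcal D\subseteq PX$ and $\widehat F\in PX$, $\mathcal D\Rightarrow_P\widehat F\in\mathcal U$ implies $\mathcal D\cap\mathcal U\ne\emptyset$. 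*)

(* Defs.v *)
From HB Require Import structures.
From mathcomp Require Import all_boot.
From mathcomp Require Import boolp classical_sets functions cardinality filter.
From mathcomp Require Import topology.

Set Implicit Arguments.
Unset Strict Implicit.
Unset Printing Implicit Defensive.

Local Open Scope classical_set_scope.

Definition directed_set (T : Type) (r : T -> T -> Prop) (D : set T) : Prop :=
  D !=set0 /\
  forall F : set T, finite_set F -> F !=set0 -> F `<=` D ->
    exists2 u, D u & forall x, F x -> r x u.

Section Specialization.
Variable X : topologicalType.

Definition spec (x y : X) : Prop := closure [set y] x.

Definition upset (A : set X) : set X := [set x | exists2 a, A a & spec a x].

Definition downset (A : set X) : set X := [set x | exists2 a, A a & spec x a].

Definition directed (D : set X) : Prop := directed_set spec D.

(* The section filter of D viewed as a net indexed by itself. *)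
Definition net_filter (D : set X) : set_system X :=
  filter_from D (fun d => [set e | D e /\ spec d e]).

Definition dlim (D : set X) : set X := [set x | net_filter D --> x].

Definition directed_open (U : set X) : Prop :=
  forall (D : set X) (x : X), directed D -> U x -> dlim D x -> D `&` U !=set0.

Definition directed_space : Prop :=
  kolmogorov_space X /\ forall U : set X, directed_open U <-> open U.

End Specialization.

Lemma spec_refl (X : topologicalType) (x : X) : spec x x.
Proof. exact: subset_closure. Qed.

Lemma spec_nbhs (X : topologicalType) (x y : X) (A : set X) :
  spec x y -> nbhs x A -> A y.
Proof. by move=> xy /xy [z [/= -> Ay]]. Qed.

Lemma spec_trans (X : topologicalType) (x y z : X) :
  spec x y -> spec y z -> spec x z.
Proof.
move=> xy yz A /nbhs_interior /(spec_nbhs xy) Ay.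
by exists z; split=> //; exact: spec_nbhs yz Ay.
Qed.

Lemma directed_pair (T : Type) (r : T -> T -> Prop) (D : set T) (a b : T) :
  directed_set r D -> D a -> D b -> exists u, [/\ D u, r a u & r b u].
Proof.
move=> [_ H] Da Db.
have [] := H [set a; b].
- by rewrite finite_setU; split; exact: finite_set1.
- by exists a; left.
- by move=> _ [->|->].
by move=> u Du ru; exists u; split=> //; apply: ru; [left|right].
Qed.

Lemma directed_set1 (T : Type) (r : T -> T -> Prop) (a : T) :
  r a a -> directed_set r [set a].
Proof.
move=> raa; split; first by exists a.
by move=> F _ _ Fa; exists a => // x /Fa ->.
Qed.

Lemma directed_tail (T : Type) (r : T -> T -> Prop) (D : set T) (a : T) :
  (forall x y z, r x y -> r y z -> r x z) -> r a a ->
  directed_set r D -> D a -> directed_set r (D `&` r a).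
Proof.
move=> rT raa dD Da; split; first by exists a.
move=> F finF F0 FD; case: (dD) => _ /(_ F finF F0) [x /FD []//|u Du uF].
have [v [Dv uv av]] := directed_pair dD Du Da.
by exists v => // x /uF xu; exact: rT xu uv.
Qed.

Lemma dlim_set1 (X : topologicalType) (x y : X) : spec x y -> dlim [set y] x.
Proof.
by move=> xy A /(spec_nbhs xy) Ay; exists y => // z [-> _].
Qed.

(* The tensor product of directed spaces: the cartesian product carrying the
   topology of sets that are open for pointwise directed sets.  It is in general
   finer than the product topology, hence the type alias. *)
Definition dprod (X Y : topologicalType) : Type := (X * Y)%type.

Section DProd.
Variables X Y : topologicalType.

Definition pw_spec (p q : X * Y) : Prop := spec p.1 q.1 /\ spec p.2 q.2.

Definition dprod_open (U : set (X * Y)) : Prop :=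
  forall (D : set (X * Y)) (x : X) (y : Y), directed_set pw_spec D -> U (x, y) ->
    dlim (fst @` D) x -> dlim (snd @` D) y -> U `&` D !=set0.

Lemma dprod_openT : dprod_open setT.
Proof. by move=> D x y [[d Dd] _] _ _ _; exists d. Qed.

Lemma dprod_openI : setI_closed dprod_open.
Proof.
move=> U V oU oV D x y dD [Uxy Vxy] Dx Dy.
have [[a b] [Uab Dab]] := oU _ _ _ dD Uxy Dx Dy.
pose D' := D `&` pw_spec (a, b).
have refl p : pw_spec p p by split; exact: spec_refl.
have trans p q r : pw_spec p q -> pw_spec q r -> pw_spec p r.
  by move=> [p1 p2] [q1 q2]; split; [exact: spec_trans p1 q1|exact: spec_trans p2 q2].
have dD' : directed_set pw_spec D' by exact: directed_tail.
have D'x : dlim (fst @` D') x.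
  move=> A /Dx [_ [p Dp <-] pA]; have [q [Dq pq abq]] := directed_pair dD Dp Dab.
  exists q.1; first by exists q.
  move=> _ [[r [Dr _] <-] qr]; apply: pA; split; first by exists r.
  by apply: spec_trans qr; case: pq.
have D'y : dlim (snd @` D') y.
  move=> A /Dy [_ [p Dp <-] pA]; have [q [Dq pq abq]] := directed_pair dD Dp Dab.
  exists q.2; first by exists q.
  move=> _ [[r [Dr _] <-] qr]; apply: pA; split; first by exists r.
  by apply: spec_trans qr; case: pq.
have [q [Vq [Dq [aq bq]]]] := oV _ _ _ dD' Vxy D'x D'y.
exists q; split=> //; split=> //.
have ox : dlim (fst @` [set q]) a by rewrite image_set1; exact: dlim_set1.
have oy : dlim (snd @` [set q]) b by rewrite image_set1; exact: dlim_set1.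
by have [z [Uz <-]] := oU _ _ _ (directed_set1 (refl q)) Uab ox oy.
Qed.

Lemma dprod_open_bigU (I : Type) (f : I -> set (X * Y)) :
  (forall i, dprod_open (f i)) -> dprod_open (\bigcup_i f i).
Proof.
move=> fo D x y dD [i _ fi] Dx Dy.
by have [z [fz Dz]] := fo i _ _ _ dD fi Dx Dy; exists z; split=> //; exists i.
Qed.

HB.instance Definition _ := Choice.on (dprod X Y).
HB.instance Definition _ := isOpenTopological.Build (dprod X Y)
  dprod_openT dprod_openI dprod_open_bigU.

End DProd.

Definition directed_semilattice (X : topologicalType) (add : X -> X -> X) : Prop :=
  [/\ directed_space X,
      continuous (fun p : dprod X X => add p.1 p.2),
      idempotent_op add, associative add & commutative add].

Definition directed_semilattice_hom (X Y : topologicalType)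
    (addX : X -> X -> X) (addY : Y -> Y -> Y) (f : X -> Y) : Prop :=
  continuous f /\ {morph f : x y / addX x y >-> addY x y}.

Definition directed_convex_powerspace (X Z : topologicalType)
    (add : Z -> Z -> Z) : Prop :=
  directed_semilattice add /\
  exists i : X -> Z, continuous i /\
    forall (Y : topologicalType) (addY : Y -> Y -> Y),
      directed_semilattice addY ->
      forall f : X -> Y, continuous f ->
        exists! fbar : Z -> Y,
          directed_semilattice_hom add addY fbar /\ f = fbar \o i.

Definition finite_nonempty (T : Type) : set (set T) :=
  [set F | finite_set F /\ F !=set0].

Definition hat_pair (X : topologicalType) (F : set X) : set X * set X :=
  (downset F, upset F).

Definition PX (X : topologicalType) : Type :=
  set_type (@hat_pair X @` @finite_nonempty X).

Section PXTopology.
Variable X : topologicalType.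

Definition lower (p : PX X) : set X := (val p).1.
Definition upper (p : PX X) : set X := (val p).2.

Definition hat (F : set X) (HF : finite_nonempty F) : PX X :=
  exist _ (hat_pair F) (mem_set (imageP (@hat_pair X) HF)).

Definition le_P (p q : PX X) : Prop :=
  lower p `<=` lower q /\ upper q `<=` upper p.

(* [convP D F] is the relation D =>_P hat F.  Since [lower p] and [upper p] are
   the down-set and up-set of any finite set representing p, the choice of the
   representatives of the members of D is immaterial. *)
Definition convP (D : set (PX X)) (F : set X) : Prop :=
  exists (k : nat) (E : 'I_k -> set X),
    [/\ forall j, directed (E j),
        forall j, E j `<=` \bigcup_(p in D) lower p,
        forall j, F `&` dlim (E j) !=set0,
        F `<=` \bigcup_j dlim (E j) &
        forall d : 'I_k -> X, (forall j, E j (d j)) ->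
          exists2 p, D p & upper p `<=` upset (range d)].

Definition openP (U : set (PX X)) : Prop :=
  forall (D : set (PX X)) (F : set X) (HF : finite_nonempty F),
    directed_set le_P D -> convP D F -> U (hat HF) -> D `&` U !=set0.

Lemma hatP (p : PX X) : exists F (HF : finite_nonempty F), p = hat HF.
Proof.
case: p => p pP; have [F HF Fp] := set_mem pP.
by exists F, HF; apply: val_inj.
Qed.

Lemma le_P_refl p : le_P p p. Proof. by split. Qed.

Lemma le_P_trans p q r : le_P p q -> le_P q r -> le_P p r.
Proof.
move=> [pq qp] [qr rq]; split; first exact: subset_trans qr.
exact: subset_trans qp.
Qed.

Lemma openP_up U p q : openP U -> le_P p q -> U p -> U q.
Proof.
move=> oU; have [F [HF ->]] := hatP p; have [G [HG ->]] := hatP q.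
move=> [FG GF] UF.
suff cFG : convP [set hat HG] F.
  by have [_ [-> ]] := oU _ _ HF (directed_set1 (le_P_refl (hat HG))) cFG UF.
have [/finite_seqP [s sG] _] := HG.
have sGP x : G x <-> x \in s by rewrite sG.
exists (size s), (fun j => [set tnth (in_tuple s) j]).
have Gs j : G (tnth (in_tuple s) j) by apply/sGP/mem_tnth.
split.
- by move=> j; exact/directed_set1/spec_refl.
- move=> j _ ->; exists (hat HG); first by [].
  by exists (tnth (in_tuple s) j) => //; exact: spec_refl.
- move=> j; have [|a Fa aj] := GF (tnth (in_tuple s) j).
    by exists (tnth (in_tuple s) j) => //; exact: spec_refl.
  by exists a; split=> //; exact: dlim_set1.
- move=> x Fx; have [|y /sGP ys xy] := FG x.
    by exists x => //; exact: spec_refl.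
  have /tnthP [j yj] : y \in in_tuple s by [].
  by exists j => //; apply: dlim_set1; rewrite -yj.
- move=> d dE; exists (hat HG) => // x [y /sGP ys yx].
  have /tnthP [j yj] : y \in in_tuple s by [].
  by exists y => //; exists j => //; rewrite dE.
Qed.

Lemma openPT : openP setT.
Proof. by move=> D F HF [[d Dd] _] _ _; exists d. Qed.

Lemma openPI : setI_closed openP.
Proof.
move=> U V oU oV D F HF dD cD [UF VF].
have [p [Dp Up]] := oU _ _ _ dD cD UF.
have dD' : directed_set le_P (D `&` le_P p).
  exact: (directed_tail le_P_trans (le_P_refl p)).
suff cD' : convP (D `&` le_P p) F.
  have [q [[Dq pq] Vq]] := oV _ _ _ dD' cD' VF.
  by exists q; split=> //; split=> //; exact: openP_up Up.
case: cD => k [E [dE EL FE FlE Eup]]; exists k, E; split=> //.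
- move=> j x /EL [q Dq qx].
  have [r [Dr [qr _] pr]] := directed_pair dD Dq Dp.
  by exists r => //; exact: qr.
- move=> d /Eup [q Dq qd].
  have [r [Dr [_ qr] pr]] := directed_pair dD Dq Dp.
  by exists r => //; exact: subset_trans qd.
Qed.

Lemma openP_bigU (I : Type) (f : I -> set (PX X)) :
  (forall i, openP (f i)) -> openP (\bigcup_i f i).
Proof.
move=> fo D F HF dD cD [i _ fi].
by have [z [Dz fz]] := fo i _ _ _ dD cD fi; exists z; split=> //; exists i.
Qed.

HB.instance Definition _ := Choice.on (PX X).
HB.instance Definition _ := isOpenTopological.Build (PX X)
  openPT openPI openP_bigU.

Lemma finite_nonemptyU (F G : set X) :
  finite_nonempty F -> finite_nonempty G -> finite_nonempty (F `|` G).
Proof.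
move=> [finF [x Fx]] [finG _]; split; first by rewrite finite_setU.
by exists x; left.
Qed.

Lemma hat_pairU (F G : set X) : hat_pair (F `|` G) =
  ((hat_pair F).1 `|` (hat_pair G).1, (hat_pair F).2 `|` (hat_pair G).2).
Proof.
congr (_, _); apply/seteqP; split=> x.
- by move=> [a [Fa|Ga] xa]; [left|right]; exists a.
- by move=> [[a Fa xa]|[a Ga xa]]; exists a => //; [left|right].
- by move=> [a [Fa|Ga] xa]; [left|right]; exists a.
- by move=> [[a Fa xa]|[a Ga xa]]; exists a => //; [left|right].
Qed.

Lemma oplus_subproof (p q : PX X) : (lower p `|` lower q, upper p `|` upper q)
  \in @hat_pair X @` @finite_nonempty X.
Proof.
have [F [HF ->]] := hatP p; have [G [HG ->]] := hatP q.
rewrite /lower /upper /= -hat_pairU; apply: mem_set.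
by exists (F `|` G) => //; exact: finite_nonemptyU.
Qed.

(* hat F (+) hat G = hat (F `|` G), see [oplus_hat]; taking unions of the
   components makes the operation independent of the representatives. *)
Definition oplus (p q : PX X) : PX X :=
  exist _ (lower p `|` lower q, upper p `|` upper q) (oplus_subproof p q).

Lemma oplus_hat (F G : set X) (HF : finite_nonempty F) (HG : finite_nonempty G) :
  oplus (hat HF) (hat HG) = hat (finite_nonemptyU HF HG).
Proof. by apply: val_inj; rewrite /= hat_pairU. Qed.

End PXTopology.

Lemma open_dprodE (X Y : topologicalType) :
  (@open (dprod X Y) : set_system (dprod X Y)) = @dprod_open X Y.
Proof. by []. Qed.

Lemma open_PXE (X : topologicalType) :
  (@open (PX X) : set_system (PX X)) = @openP X.
Proof. by []. Qed.

(* Main.v *)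
Require Import Defs.
From mathcomp Require Import all_boot.
From mathcomp Require Import boolp classical_sets filter topology.
From mathcomp Require Import cardinality.

(** The finite subsets of X, up to the Egli-Milner preorder, are the free
    semilattice generated by the poset X; the topology on [PX X] is chosen so
    that this remains true for directed spaces.

    The powerspace is a directed semilattice.  Its specialization order is [le_P]
    ([spec_PXE]): the sets of elements not below a given q are open
    ([openP_nle]), while open sets are upward closed.  Hence every
    [convP]-convergence is a topological convergence of a directed set, and a
    directed open set satisfies the condition defining the topology
    ([directed_space_PX]).  Adding a fixed element preserves [convP], so the
    union is separately continuous ([openP_oplus]); on the tensor product, whose
    topology tests only directed sets, separate continuity gives joint
    continuity ([oplus_continuous]).

    Universality.  In a directed semilattice Y, the sum of a finite nonempty set
    A is the least upper bound of A for the order [a + b = b]; this [is_sum]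
    depends on A alone, with no enumeration or repetitions to handle.  A
    homomorphism extending f : X -> Y has to send hat F to the sum of f(F)
    ([hom_extends]), which gives uniqueness.  Existence rests on one fact about
    Y: a finite sum of monotone nets converging over a common directed index set
    converges to the sum of the limits ([sum_converges]).
    - With a one-point index set, convergence is the specialization order, and
      the fact says that sums are Egli-Milner monotone ([le_P_sum]).  As Y is
      T0, the sum of f(F) depends on hat F only ([extension_ex]).
    - When a family converges to hat F along directed sets E_1, ..., E_k, take as
      index set the product of the E_j.  Sum the nets d |-> f(d_j), once for each
      pair (j, x) with x in F a limit of E_j: the limit is the sum of f(F), and
      by idempotency the net is the sum of f over {d_1, ..., d_k}.  A tail of
      the family lies above each hat {d_1, ..., d_k}, so the extension is
      continuous ([extension_continuous]). *)

Set Implicit Arguments.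
Unset Strict Implicit.
Unset Printing Implicit Defensive.

Local Open Scope classical_set_scope.

(** * Finite nonempty sets and directed sets *)

Lemma finite_nonempty_ind (T : choiceType) (P : set T -> Prop) :
  (forall x, P [set x]) ->
  (forall A B, finite_nonempty A -> finite_nonempty B ->
    P A -> P B -> P (A `|` B)) ->
  forall F, finite_nonempty F -> P F.
Proof.
move=> P1 PU F [/finite_seqP [s ->]] [x xs].
case: s xs => [//|a s] _; elim: s a => [|b s IH] a.
  by have -> : [set` [:: a]] = [set a]
    by apply/seteqP; split=> z /=; rewrite inE => /eqP.
have -> : [set` [:: a, b & s]] = [set a] `|` [set` b :: s].
  apply/seteqP; split=> z /=; rewrite !in_cons.
    by case/predU1P; [left|right].
  by move=> [->|->]; rewrite ?eqxx ?orbT.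
apply: PU (IH b) => //.
  by split; [exact: finite_set1|exists a].
by split; [exact: finite_seq|exists b => /=; rewrite inE eqxx].
Qed.

Lemma finite_nonempty_image (T U : choiceType) (g : T -> U) (F : set T) :
  finite_nonempty F -> finite_nonempty (g @` F).
Proof. by move=> [finF [x Fx]]; split; [exact: finite_image|exists (g x), x]. Qed.

Lemma finite_nonempty1 (T : choiceType) (x : T) : finite_nonempty [set x].
Proof. by split; [exact: finite_set1|exists x]. Qed.

Lemma directed_image (I T : choiceType) (r : I -> I -> Prop) (q : T -> T -> Prop)
    (g : I -> T) (D : set I) :
  (forall i j, r i j -> q (g i) (g j)) ->
  directed_set r D -> directed_set q (g @` D).
Proof.
move=> gM [[i Di] dD]; split; first by exists (g i), i.
move=> F finF [t Ft] FD.
have /choice [c cP] x : exists j, F x -> D j /\ g j = x.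
  by have [/FD [j Dj gj]|nFx] := pselect (F x); [exists j|exists i].
have [|||u Du uF] := dD (c @` F).
- exact: finite_image.
- by exists (c t), t.
- by move=> _ [x /cP [? _] <-].
exists (g u); first by exists u.
by move=> x Fx; case: (cP x Fx) => _ <-; apply/gM/uF; exists x.
Qed.

(** * Specialization order and limits of directed sets *)

Section SpecializationTheory.
Variable X : topologicalType.

Lemma specP (x y : X) : spec x y <-> forall U, open U -> U x -> U y.
Proof.
split=> [xy U oU Ux|H A]; first by apply: spec_nbhs xy _; apply: open_nbhs_nbhs.
rewrite nbhsE => -[U [oU Ux] UA]; exists y; split=> //.
by apply: UA; exact: H oU Ux.
Qed.

Lemma kolmogorov_spec_anti (x y : X) :
  kolmogorov_space X -> spec x y -> spec y x -> x = y.
Proof.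
move=> K xy yx; apply/eqP; apply: contrapT => /negP /K [A].
by case=> -[/set_mem nA /set_mem nAz]; apply: nAz;
  [exact: spec_nbhs xy nA|exact: spec_nbhs yx nA].
Qed.

Lemma spec_anti_kolmogorov :
  (forall x y : X, spec x y -> spec y x -> x = y) -> kolmogorov_space X.
Proof.
move=> H x y; apply: contraNP => /forallNP nA; apply/eqP.
have key a b : (forall A : set X, ~ (A \in nbhs a /\ b \in ~` A)) -> spec a b.
  move=> nab; apply/specP => U oU Ua; apply: contrapT => nUb.
  by apply: (nab U); split; apply: mem_set => //; exact: open_nbhs_nbhs.
by apply: H; apply: key => A ?; apply: (nA A); [left|right].
Qed.

Lemma dlim_open (D U : set X) (x : X) :
  dlim D x -> open U -> U x -> D `&` U !=set0.
Proof.
move=> Dx oU Ux; have [|d Dd dU] := Dx U; first exact: open_nbhs_nbhs.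
by exists d; split=> //; apply: dU; split=> //; exact: spec_refl.
Qed.

(** Opens are upward closed, so a point of D in an open set brings with it the
    whole tail of D above that point. *)
Lemma open_dlim (D : set X) (x : X) :
  (forall U, open U -> U x -> D `&` U !=set0) -> dlim D x.
Proof.
move=> H A; rewrite nbhsE => -[U [oU Ux] UA]; have [d [Dd Ud]] := H U oU Ux.
by exists d => // e [_ de]; apply: UA; exact: (specP d e).1 de U oU Ud.
Qed.

Lemma open_directed_open (U : set X) : open U -> directed_open U.
Proof. by move=> oU D x _ Ux Dx; exact: dlim_open Dx oU Ux. Qed.

Lemma dlim_spec (y : X) (D : set X) (x : X) :
  (forall d, D d -> spec d y) -> dlim D x -> spec x y.
Proof.
move=> Dy Dx; apply/specP => U oU Ux; have [d [Dd Ud]] := dlim_open Dx oU Ux.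
by apply: (specP d y).1 Ud => //; exact: Dy.
Qed.

(** The down-set of a finite set is a finite union of closures of points, hence
    closed. *)
Lemma finite_downset_dlim (G D : set X) (x : X) :
  finite_set G -> D `<=` downset G -> dlim D x -> downset G x.
Proof.
move=> finG DG Dx.
have cG : closed (downset G).
  have -> : downset G = \bigcup_(g in G) closure [set g].
    by apply/seteqP; split=> [z [g Gg zg]|z [g Gg zg]]; exists g.
  by apply: closed_bigcup => // g _; exact: closed_closure.
apply: contrapT => nGx; have [|d [Dd]] := @dlim_open D (~` downset G) x Dx _ nGx.
  exact: closed_openC.
by apply; exact: DG.
Qed.

End SpecializationTheory.

Lemma continuous_spec (X Y : topologicalType) (f : X -> Y) (x y : X) :
  continuous f -> spec x y -> spec (f x) (f y).
Proof.
move=> /continuousP cf xy; apply/specP => U oU Ux.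
exact: (specP x y).1 xy _ (cf U oU) Ux.
Qed.

(** * The powerspace as a directed semilattice *)

Section Powerspace.
Variable X : topologicalType.
Implicit Types (p q : PX X) (F G : set X).

Lemma le_P_anti p q : le_P p q -> le_P q p -> p = q.
Proof.
move=> [pq qp] [qp' pq']; apply: val_inj; apply: injective_projections => /=.
  by apply/seteqP; split.
by apply/seteqP; split.
Qed.

(** If every member of D is below q = hat G, so is any F with [convP D F].  The
    lower halves pass to the limit since the down-set of G is closed.  For the
    upper halves, let g in G: every tuple (d_j) has an entry below g, so some
    E_j lies entirely below g, and so does the point of F that is a limit of
    this E_j. *)
Lemma openP_nle q : openP [set p | ~ le_P p q].
Proof.
move=> D F HF dD [k [E [dE EL FE FlE Eup]]] /= nFq.
apply: contrapT => nD; apply: nFq.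
have Dq p : D p -> le_P p q.
  by move=> Dp; apply: contrapT => npq; apply: nD; exists p.
have [G [HG qG]] := hatP q; split.
- move=> x [a /FlE [j _ Ea] xa].
  have : downset G a.
    apply: finite_downset_dlim Ea; first by case: (HG).
    by move=> e /EL [p /Dq [pq _] /pq]; rewrite qG.
  by move=> [g Gg ag]; rewrite qG; exists g => //; exact: spec_trans ag.
- move=> y; rewrite {1}qG => -[g Gg gy].
  suff [j Ejg] : exists j, forall e, E j e -> spec e g.
    have [a [Fa Ea]] := FE j; exists a => //.
    exact: spec_trans (dlim_spec Ejg Ea) gy.
  apply: contrapT => /forallNP nE.
  (* Otherwise a tuple with no entry below g could be chosen. *)
  have /choice [d dP] j : exists e, E j e /\ ~ spec e g.
    apply: contrapT => /forallNP H; apply: (nE j) => e Ee.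
    by apply: contrapT => neg; apply: (H e).
  have [|p Dp pd] := Eup d; first by move=> j; case: (dP j).
  have [_] := Dq p Dp; rewrite qG => /(_ g) /(_ _)/pd [|_ [j _ <-]].
    by exists g => //; exact: spec_refl.
  by case: (dP j).
Qed.

Lemma spec_PXE p q : spec p q <-> le_P p q.
Proof.
split=> [/specP pq|pq]; last by apply/specP => U oU; exact: openP_up pq.
apply: contrapT => npq.
by apply: (pq [set r | ~ le_P r q] (@openP_nle q) npq); exact: le_P_refl.
Qed.

Lemma directed_PXE (D : set (PX X)) : directed D <-> directed_set (@le_P X) D.
Proof.
by split=> -[D0 dD]; split=> // F fF F0 /(dD F fF F0) [u Du uF];
  exists u => // x /uF /spec_PXE.
Qed.

Lemma convP_dlim (D : set (PX X)) F (HF : finite_nonempty F) :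
  directed_set (@le_P X) D -> convP D F -> dlim D (hat HF).
Proof. by move=> dD cD; apply: open_dlim => U oU UF; exact: oU dD cD UF. Qed.

Lemma directed_space_PX : directed_space (PX X).
Proof.
split.
  by apply: spec_anti_kolmogorov => p q /spec_PXE pq /spec_PXE; exact: le_P_anti.
move=> U; split; last exact: open_directed_open.
move=> dU; rewrite open_PXE => D F HF dD cD UF; apply: dU UF _; first exact/directed_PXE.
exact: convP_dlim.
Qed.

Lemma oplusC : commutative (@oplus X).
Proof. by move=> p q; apply: val_inj; congr (_, _); exact: setUC. Qed.

Lemma oplusA : associative (@oplus X).
Proof. by move=> p q r; apply: val_inj; congr (_, _); exact: setUA. Qed.

Lemma oplusxx : idempotent_op (@oplus X).
Proof.
move=> p; apply: val_inj; rewrite /= !setUid.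
by rewrite [RHS]surjective_pairing.
Qed.

Lemma oplus_le p q r : le_P p q -> le_P (oplus p r) (oplus q r).
Proof. by move=> [pq qp]; split=> x [|]; by [left; auto|right]. Qed.

(** If D converges to hat F along the sets E_j, then D (+) hat G converges to
    hat (F `|` G) along the E_j together with the singletons of G. *)
Lemma openP_oplus (U : set (PX X)) r : openP U -> openP [set p | U (oplus p r)].
Proof.
move=> oU D F HF dD [k [E [dE EL FE FlE Eup]]] /=.
have [G [HG ->]] := hatP r; rewrite oplus_hat => UFG.
have [/finite_seqP [s sG] [g0 Gg0]] := HG.
have sGP x : G x <-> x \in s by rewrite sG.
suff cD : convP ((fun p => oplus p (hat HG)) @` D) (F `|` G).
  have dD' : directed_set (@le_P X) ((fun p => oplus p (hat HG)) @` D).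
    by apply: directed_image dD => p q; exact: oplus_le.
  have [_ [[p Dp <-] Up]] := oU _ _ _ dD' cD UFG.
  by exists p.
pose E' (j : 'I_(k + size s)) : set X := match fintype.split j with
  | inl a => E a | inr b => [set tnth (in_tuple s) b] end.
have Gs j : G (tnth (in_tuple s) j) by apply/sGP/mem_tnth.
exists (k + size s)%N, E'; split.
- move=> j; rewrite /E'; case: fintype.split => // b.
  exact/directed_set1/spec_refl.
- move=> j x; rewrite /E'; case: fintype.split => [a /EL [p Dp px]|b ->].
    by exists (oplus p (hat HG)); [exists p|left].
  have [[d Dd] _] := dD; exists (oplus d (hat HG)); first by exists d.
  right; exists (tnth (in_tuple s) b) => //; exact: spec_refl.
- move=> j; rewrite /E'; case: fintype.split => [a|b].
    by have [x [Fx Ex]] := FE a; exists x; split=> //; left.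
  exists (tnth (in_tuple s) b); split; first by right.
  exact/dlim_set1/spec_refl.
- move=> x [/FlE [a _ Eax]|/sGP xs].
    by exists (unsplit (inl a)) => //; rewrite /E' unsplitK.
  have /tnthP [b xb] : x \in in_tuple s by [].
  exists (unsplit (inr b)) => //; rewrite /E' unsplitK -xb.
  exact/dlim_set1/spec_refl.
- move=> d dE'.
  have [a|p Dp pd] := Eup (fun a => d (unsplit (inl a))).
    by have := dE' (unsplit (inl a)); rewrite /E' unsplitK.
  exists (oplus p (hat HG)); first by exists p.
  move=> x [/pd [_ [a _ <-] ax]|[y /sGP ys yx]].
    by exists (d (unsplit (inl a))).
  have /tnthP [b yb] : y \in in_tuple s by [].
  exists y => //; exists (unsplit (inr b)) => //.
  by have := dE' (unsplit (inr b)); rewrite /E' unsplitK -yb.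
Qed.

(** Separate continuity moves first p, then q, into D; the two elements of D
    so obtained have a common upper bound in D, and open sets are upward
    closed. *)
Lemma oplus_continuous :
  continuous (fun p : dprod (PX X) (PX X) => oplus p.1 p.2).
Proof.
apply/continuousP => U oU; rewrite open_dprodE => D p q dD Upq Dp Dq.
have [_ [[d Dd <-] Ud]] := dlim_open Dp (@openP_oplus U q oU) Upq.
have Ud' : U (oplus q d.1) by rewrite oplusC.
have [_ [[e De <-] Ue]] := dlim_open Dq (@openP_oplus U d.1 oU) Ud'.
have [c [Dc [/spec_PXE dc _] [_ /spec_PXE ec]]] := directed_pair dD Dd De.
exists c; split=> //; apply: (@openP_up X U _ _ oU _ Ue).
apply: le_P_trans (oplus_le _ ec) _.
by rewrite (oplusC c.1); rewrite ![oplus c.2 _]oplusC; exact: oplus_le.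
Qed.

Lemma directed_semilattice_PX : directed_semilattice (@oplus X).
Proof.
split; [exact: directed_space_PX|exact: oplus_continuous|exact: oplusxx|
  exact: oplusA|exact: oplusC].
Qed.

Definition unit_PX (x : X) : PX X := hat (finite_nonempty1 x).

(** When D converges to x, the singletons of D converge to hat {x} along the one
    directed set D. *)
Lemma unit_PX_continuous : directed_space X -> continuous unit_PX.
Proof.
move=> [_ dX]; apply/continuousP => U oU; apply/dX => D x dD Ux Dx.
have dD' : directed_set (@le_P X) (unit_PX @` D).
  apply: directed_image dD => a b ab; split.
    by move=> z [_ -> za]; exists b => //; exact: spec_trans ab.
  by move=> z [_ -> bz]; exists a => //; exact: spec_trans bz.
suff cD : convP (unit_PX @` D) [set x].
  have [_ [[d Dd <-] Ud]] := oU _ _ _ dD' cD Ux.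
  by exists d.
exists 1%N, (fun=> D); split=> //.
- move=> _ d Dd; exists (unit_PX d); first by exists d.
  by exists d => //; exact: spec_refl.
- by move=> _; exists x.
- by move=> _ ->; exists ord0.
- move=> d dD1; exists (unit_PX (d ord0)); first by exists (d ord0).
  by move=> z [_ -> dz]; exists (d ord0) => //; exists ord0.
Qed.

End Powerspace.

(** * Finite sums in a directed semilattice *)

Section Sums.
Variables (Y : topologicalType) (add : Y -> Y -> Y).
Hypothesis hY : directed_semilattice add.

Let addxx : idempotent_op add. Proof. by case: hY. Qed.
Let addA : associative add. Proof. by case: hY. Qed.
Let addC : commutative add. Proof. by case: hY. Qed.

(** The sum of a finite nonempty set A is its least upper bound for the order
    [a <= b iff a + b = b]; the definition is the universal property of that
    bound. *)
Definition is_sum (A : set Y) (y : Y) : Prop :=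
  forall b, add y b = b <-> forall a, A a -> add a b = b.

Lemma is_sum_unique (A : set Y) (y z : Y) : is_sum A y -> is_sum A z -> y = z.
Proof.
move=> Ay Az; have yz : add y z = z by apply/Ay/Az; exact: addxx.
have zy : add z y = y by apply/Az/Ay; exact: addxx.
by rewrite -zy addC.
Qed.

Lemma is_sum1 (y : Y) : is_sum [set y] y.
Proof. by move=> b; split=> [yb _ ->//|]; exact. Qed.

Lemma is_sumU (A B : set Y) (y z : Y) :
  is_sum A y -> is_sum B z -> is_sum (A `|` B) (add y z).
Proof.
move=> Ay Bz b; split=> [yzb a [Aa|Ba]|H].
- apply: (Ay b).1 Aa; rewrite -yzb !addA addxx //.
- by apply: (Bz b).1 Ba; rewrite -yzb (addC y) !addA addxx.
- rewrite -addA ((Bz b).2 _); last by move=> a Ba; apply: H; right.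
  by apply/Ay => a Aa; apply: H; left.
Qed.

(** For a monotone net over a directed set S this is convergence to y, since
    opens are upward closed. *)
Definition converges (I : Type) (S : set I) (u : I -> Y) (y : Y) : Prop :=
  forall V, open V -> V y -> exists2 i, S i & V (u i).

Section Nets.
Variables (I : choiceType) (r : I -> I -> Prop) (S : set I).
Hypothesis dS : directed_set r S.

(** The pairs (u i, v i) form a pointwise directed set, of the kind that tests
    openness in the tensor product; this is where joint continuity of the
    operation is used. *)
Lemma add_converges (u v : I -> Y) (y z : Y) :
  (forall i j, r i j -> spec (u i) (u j)) ->
  (forall i j, r i j -> spec (v i) (v j)) ->
  converges S u y -> converges S v z ->
  converges S (fun i => add (u i) (v i)) (add y z).
Proof.
move=> uM vM uy vz V oV Vyz.
have dD : directed_set (@pw_spec Y Y) ((fun i => (u i, v i)) @` S).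
  by apply: directed_image dS => i j ij; split; [exact: uM|exact: vM].
have [_ /continuousP /(_ V oV) + _ _ _] := hY.
move=> /(_ _ y z dD Vyz) [||w [Vw [i Si iw]]];
  last by exists i => //; move: Vw; rewrite -iw.
- apply: open_dlim => W oW /(uy W oW) [i Si Wi].
  by exists (u i); split=> //; exists (u i, v i) => //; exists i.
- apply: open_dlim => W oW /(vz W oW) [i Si Wi].
  by exists (v i); split=> //; exists (u i, v i) => //; exists i.
Qed.

End Nets.

Lemma spec_converges (y z : Y) : spec y z <-> converges setT (fun _ : unit => z) y.
Proof.
split=> [/specP yz V oV Vy|H]; first by exists tt => //; exact: yz Vy.
by apply/specP => V oV Vy; have [] := H V oV Vy.
Qed.

(* By [spec_converges], the specialization order is convergence over this
   one-point index set, so statements about order are instances of statements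
   about convergence. *)
Let directed_unit : directed_set (fun _ _ : unit => True) setT.
Proof. by split=> [|F _ _ _]; exists tt. Qed.

Lemma add_spec (a b c d : Y) :
  spec a b -> spec c d -> spec (add a c) (add b d).
Proof.
move=> /spec_converges ab /spec_converges cd; apply/spec_converges.
by apply: (add_converges directed_unit) ab cd => _ _ _; exact: spec_refl.
Qed.

Lemma sum_converges (I T : choiceType) (r : I -> I -> Prop) (S : set I)
    (L : set T) (u : T -> I -> Y) (y : T -> Y) :
  directed_set r S -> finite_nonempty L ->
  (forall t i j, r i j -> spec (u t i) (u t j)) ->
  (forall t, L t -> converges S (u t) (y t)) ->
  exists Z z, [/\ forall i, is_sum ((u^~ i) @` L) (Z i),
    is_sum (y @` L) z & converges S Z z].
Proof.
move=> dS HL uM uy.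
(* The induction needs the net of sums to be monotone as well, in order to apply
   [add_converges]. *)
suff [Z [z [? ? _ ?]]] : exists Z z, [/\ forall i, is_sum ((u^~ i) @` L) (Z i),
    is_sum (y @` L) z, forall i j, r i j -> spec (Z i) (Z j) & converges S Z z].
  by exists Z, z.
elim/finite_nonempty_ind: L / HL uy => [t ut|A B _ _ IA IB uAB].
  exists (u t), (y t); split.
  - by move=> i; rewrite image_set1; exact: is_sum1.
  - by rewrite image_set1; exact: is_sum1.
  - exact: uM.
  - exact: ut.
have [|ZA [zA [uA yA MA cA]]] := IA; first by move=> t At; apply: uAB; left.
have [|ZB [zB [uB yB MB cB]]] := IB; first by move=> t Bt; apply: uAB; right.
exists (fun i => add (ZA i) (ZB i)), (add zA zB); split.
- by move=> i; rewrite image_setU; exact: is_sumU.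
- by rewrite image_setU; exact: is_sumU.
- by move=> i j ij; apply: add_spec; [exact: MA|exact: MB].
- exact: (add_converges dS MA MB cA cB).
Qed.

Lemma is_sum_ex (A : set Y) : finite_nonempty A -> exists y, is_sum A y.
Proof.
elim/finite_nonempty_ind => [y|B C _ _ [y By] [z Cz]].
  by exists y; exact: is_sum1.
by exists (add y z); exact: is_sumU.
Qed.

(** * Extension of a continuous map *)

Section Extension.
Variables (X : topologicalType) (f : X -> Y).
Hypothesis fC : continuous f.

(** Sum over the pairs (a, b) in F x G with a below b: since hat F is below
    hat G, both projections of this relation are onto, so by idempotency the two
    sums are those of f(F) and of f(G). *)
Lemma le_P_sum (F G : set X) (HF : finite_nonempty F) (HG : finite_nonempty G)
    (y z : Y) :
  le_P (hat HF) (hat HG) -> is_sum (f @` F) y -> is_sum (f @` G) z -> spec y z.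
Proof.
move=> [FG GF] Fy Gz.
have FGP a : F a -> exists2 b, G b & spec a b.
  by move=> Fa; apply: FG; exists a => //; exact: spec_refl.
have GFP b : G b -> exists2 a, F a & spec a b.
  by move=> Gb; apply: GF; exists b => //; exact: spec_refl.
pose L : set (X * X) := (F `*` G) `&` [set t | spec t.1 t.2].
have HL : finite_nonempty L.
  split.
    by apply: finite_setIl; apply: finite_setX; [case: (HF)|case: (HG)].
  have [_ [a Fa]] := HF; have [b Gb ab] := FGP a Fa.
  by exists (a, b).
have [|t [_ st]|Z [w [LZ Lw cZ]]] :=
  @sum_converges _ _ _ _ L (fun t _ => f t.2) (fun t => f t.1) directed_unit HL.
- by move=> *; exact: spec_refl.
- exact/spec_converges/continuous_spec.
have yw : y = w.
  apply: is_sum_unique Fy _; congr is_sum: Lw; apply/seteqP; split.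
    by move=> _ [t [[Ft _] _] <-]; exists t.1.
  by move=> _ [a Fa <-]; have [b Gb ab] := FGP a Fa; exists (a, b).
have zZ : z = Z tt.
  apply: is_sum_unique Gz _; congr is_sum: (LZ tt); apply/seteqP; split.
    by move=> _ [t [[_ Gt] _] <-]; exists t.2.
  by move=> _ [b Gb <-]; have [a Fa ab] := GFP b Gb; exists (a, b).
apply/spec_converges; rewrite yw => V oV Vw.
by have [[] _ VZ] := cZ V oV Vw; exists tt => //; rewrite zZ.
Qed.

(** This formula determines g, because every element of [PX X] is some hat F. *)
Definition extends (g : PX X -> Y) : Prop :=
  forall F (HF : finite_nonempty F), is_sum (f @` F) (g (hat HF)).

Lemma extension_ex : exists g, extends g.
Proof.
have /choice [g gP] (p : PX X) : exists y, forall F (HF : finite_nonempty F),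
    p = hat HF -> is_sum (f @` F) y.
  have [F [HF pF]] := hatP p.
  have [y Fy] := is_sum_ex (finite_nonempty_image f HF).
  exists y => G HG pG; have [z Gz] := is_sum_ex (finite_nonempty_image f HG).
  suff -> : y = z by [].
  have [[K _] _ _ _ _] := hY; rewrite pG in pF.
  by apply: (kolmogorov_spec_anti K);
    [apply: le_P_sum Fy Gz|apply: le_P_sum Gz Fy]; rewrite pF; exact: le_P_refl.
by exists g => F HF; exact: gP.
Qed.

Lemma extension_hom (g : PX X -> Y) :
  extends g -> {morph g : p q / oplus p q >-> add p q}.
Proof.
move=> gP p q; have [F [HF ->]] := hatP p; have [G [HG ->]] := hatP q.
rewrite oplus_hat; apply: is_sum_unique (gP _ _) _.
by rewrite image_setU; exact: is_sumU.
Qed.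

Lemma extension_unit (g : PX X -> Y) : extends g -> f = g \o @unit_PX X.
Proof.
move=> gP; apply/funext => x /=; apply: is_sum_unique (gP _ _).
by rewrite image_set1; exact: is_sum1.
Qed.

Lemma hom_extends (g : PX X -> Y) :
  {morph g : p q / oplus p q >-> add p q} -> f = g \o @unit_PX X -> extends g.
Proof.
move=> gD gf F HF; move: (HF).
elim/finite_nonempty_ind: F / HF => [x|A B HA HB IA IB] HF.
  have -> : hat HF = unit_PX x by exact: val_inj.
  by rewrite image_set1 gf; exact: is_sum1.
have -> : hat HF = oplus (hat HA) (hat HB) by rewrite oplus_hat; exact: val_inj.
by rewrite gD image_setU; exact: is_sumU.
Qed.

(** A directed set E_j may have several limits in F, and an x in F may be the
    limit of several E_j.  Indexing the summands by all pairs (j, x) with x a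
    limit of E_j makes the limits range over the whole of F, and the terms over
    all the d_j. *)
Lemma extension_continuous (g : PX X -> Y) : extends g -> continuous g.
Proof.
move=> gP; apply/continuousP => V oV; rewrite open_PXE.
move=> D F HF dD [k [E [dE EL FE FlE Eup]]] VF.
have finI (T : choiceType) (h : 'I_k -> T) : finite_set (range h).
  by apply: finite_image; exact: finite_finset.
pose S : set ('I_k -> X) := [set d | forall j, E j (d j)].
pose r (d e : 'I_k -> X) := forall j, spec (d j) (e j).
(* The product of the E_j is directed pointwise. *)
have dS : directed_set r S.
  split.
    have /choice [d dP] j : exists e, E j e by have [[e Ee] _] := dE j; exists e.
    by exists d.
  move=> A finA [a Aa] AS.
  have /choice [d dP] j : exists e, E j e /\ forall c, A c -> spec (c j) e.
    have [_ /(_ ((fun c => c j) @` A))] := dE j.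
    case=> [|||e Ee eA].
    - exact: finite_image.
    - by exists (a j), a.
    - by move=> _ [c /AS cS <-].
    by exists e; split=> // c Ac; apply: eA; exists c.
  by exists d => [j|c Ac j]; case: (dP j) => // _; apply.
pose L : set ('I_k * X) := [set t | F t.2 /\ dlim (E t.1) t.2].
have HL : finite_nonempty L.
  split.
    have : finite_set ([set: 'I_k] `*` F).
      by apply: finite_setX; [exact: finite_finset|case: (HF)].
    by apply: sub_finite_set => t [Ft _].
  by have [_ [x Fx]] := HF; have [j _ Ex] := FlE x Fx; exists (j, x).
have [|[j x] [Fx Ex] W oW Wx|Z [z [LZ Lz cZ]]] :=
  @sum_converges _ _ r S L (fun t d => f (d t.1)) (fun t => f t.2) dS HL.
- by move=> t d e de; exact: continuous_spec.
- have oV' : open (f @^-1` W) by move: W oW {Wx}; exact/continuousP.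
  have [e [Ee We]] := dlim_open Ex oV' Wx.
  have /choice [d dP] i : exists e', E i e' /\ (i = j -> e' = e).
    have [->|nij] := pselect (i = j); first by exists e.
    by have [[e' Ee'] _] := dE i; exists e'.
  exists d; first by move=> i; case: (dP i).
  by rewrite /= (dP j).2.
have zF : z = g (hat HF).
  apply: is_sum_unique Lz _; congr is_sum: (gP F HF); apply/seteqP; split.
    by move=> _ [x Fx <-]; have [j _ Ex] := FlE x Fx; exists (j, x).
  by move=> _ [t [Ft _] <-]; exists t.2.
rewrite /preimage /= -zF in VF.
have [d Sd Vd] := cZ V oV VF.
(* p0 is above d in its upper half and c j has d j in its lower half, so a
   common upper bound q of these members of D is above hat {d_1, ..., d_k}. *)
have [p0 Dp0 p0d] := Eup d Sd.
have /choice [c cP] j : exists p, D p /\ lower p (d j).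
  by have [p Dp pd] := EL j _ (Sd j); exists p.
have [||| q Dq qP] := dD.2 (p0 |` range c).
- by rewrite finite_setU; split; [exact: finite_set1|exact: finI].
- by exists p0; left.
- by move=> _ [->//|[j _ <-]]; case: (cP j).
exists q; split=> //.
have Hd : finite_nonempty (range d).
  by split; [exact: finI|have [_ [[j _] _]] := HL; exists (d j), j].
have Zd : Z d = g (hat Hd).
  apply: is_sum_unique (LZ d) _; congr is_sum: (gP _ Hd); apply/seteqP; split.
    move=> _ [_ [j _ <-] <-]; have [x [Fx Ex]] := FE j.
    by exists (j, x).
  by move=> _ [[j x] _ <-]; exists (d j) => //; exists j.
have [G [HG qG]] := hatP q.
have dq : le_P (hat Hd) q.
  split.
    move=> x [_ [j _ <-] xd]; have [_ cd] := cP j.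
    have [|cq _] := qP (c j); first by right; exists j.
    move: (cq _ cd); rewrite qG => -[a Ga da].
    by exists a => //; exact: spec_trans da.
  have [|_ qp0] := qP p0; first by left.
  exact: subset_trans p0d.
rewrite Zd in Vd; rewrite /preimage /= qG.
apply: (specP _ _).1 Vd => //; apply: le_P_sum (gP _ Hd) (gP _ HG).
by rewrite -qG.
Qed.

End Extension.
End Sums.

Theorem theorem7p8 (X : topologicalType) (hX : directed_space X) :
  directed_convex_powerspace X (@oplus X).
Proof.
split; first exact: directed_semilattice_PX.
exists (@unit_PX X); split; first exact: unit_PX_continuous.
move=> Y add hY f fC; have [g gP] := extension_ex hY fC.
exists g; split.
  split; last exact: extension_unit gP.
  by split; [exact: extension_continuous gP|exact: extension_hom gP].
move=> h [[_ hD] hf]; apply/funext => p; have [F [HF ->]] := hatP p.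
have hE := hom_extends hY hD hf.
exact: (is_sum_unique hY (gP F HF) (hE F HF)).
Qed.
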